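(* Let $X$ be a set, let $\mathcal{H}$ be a Hilbert space, and let $\Phi : X \to \mathcal{H}$ be any map. If $\Phi$ is injective, then for any $t>0$ the function $(x,y)\mapsto \exp\left(t\langle \Phi(y),\Phi(x)\rangle_{\mathcal{H}}\right)$ on $X\times X$ is strictly positive definite. Moreover, in that case, for any $t>0$ the function $(x,y)\mapsto \exp\left(-t\|\Phi(x)-\Phi(y)\|_{\mathcal{H}}^2\right)$ on $X\times X$ is also strictly positive definite.
   Context: Hilbert spaces are complex, with inner product linear in the first variable. A function $k:X\times X\to\mathbb{C}$ is called a kernel (kernel function) if $k(y,x)=\overline{k(x,y)}$ for all $x,y\in X$ and $\sum_{i,j=1}^n c_i\overline{c_j}k(x_i,x_j)\ge 0$ for any $n\ge 1$, any $x_1,\ldots,x_n\in X$ and any $(c_1,\ldots,c_n)\in\mathbb{C}^n$. A kernel $k$ is strictly positive (strictly positive definite) if $\sum_{i,j=1}^n c_i\overline{c_j}k(x_i,x_j)>0$ for any $n\ge1$, any $n$ distinct points $x_1,\ldots,x_n\in X$ and any $(c_1,\ldots,c_n)\in\mathbb{C}^n\setminus\{\mathbf{0}\}$. *)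

(* Defs.v *)
From HB Require Import structures.
From mathcomp Require Import all_boot all_order all_algebra.
From mathcomp Require Import sesquilinear.
From mathcomp Require Import complex.
From mathcomp Require Import all_classical all_reals all_analysis.

Set Implicit Arguments.
Unset Strict Implicit.
Unset Printing Implicit Defensive.

Import Order.TTheory GRing.Theory Num.Theory.
Import numFieldNormedType.Exports.

Local Open Scope ring_scope.
Local Open Scope complex_scope.

Definition cexp (R : realType) (z : R[i]) : R[i] :=
  let: a +i* b := z in (expR a * cos b) +i* (expR a * sin b).

Local Close Scope complex_scope.

(* In the order of R[i], 0 <= z (resp. 0 < z) says that z is real and
   nonnegative (resp. positive). *)
Definition is_kernel (R : realType) (X : Type) (k : X -> X -> R[i]) : Prop :=
  (forall x y, k y x = (k x y)^*) /\
  (forall (n : nat) (x : 'I_n -> X) (c : 'rV[R[i]]_n), (1 <= n)%N ->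
    0 <= \sum_(i < n) \sum_(j < n) c 0 i * (c 0 j)^* * k (x i) (x j)).

Definition strictly_positive_kernel (R : realType) (X : Type)
    (k : X -> X -> R[i]) : Prop :=
  is_kernel k /\
  (forall (n : nat) (x : 'I_n -> X) (c : 'rV[R[i]]_n), (1 <= n)%N ->
    injective x -> c != 0 ->
    0 < \sum_(i < n) \sum_(j < n) c 0 i * (c 0 j)^* * k (x i) (x j)).

(* Main.v *)
(* For points u_i = Phi(x_i), the matrix A = (<u_j, u_i>) is Hermitian positive
   semidefinite, hence so are its entrywise powers (Schur), which are the
   derivatives at s = 0 of s |-> (exp(s A_ij)), so that
   g(s) = sum c_i c_j^* exp(s A_ij) has nonnegative derivatives of all orders
   at 0 and, by Taylor estimates, g(t) dominates each term of its Taylor series.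
   If g(t) = 0, then every entrywise power has c as an isotropic, hence null,
   vector: sum_i c_i p(A_ij) = 0 for all polynomials p and all j.  Take u_j of
   maximal norm among those with c_j <> 0: A_ij = A_jj would force
   |u_i - u_j|^2 = |u_i|^2 - |u_j|^2 <= 0, so a Lagrange polynomial gives
   c_j = 0, a contradiction.  Everything applies to Re A as well, and
   exp(- t |u - v|^2) is exp(2 t Re <u, v>) up to a rescaling. *)
Require Import Defs.
From HB Require Import structures.
From mathcomp Require Import all_boot all_order all_algebra.
From mathcomp Require Import sesquilinear spectral.
From mathcomp Require Import complex ring lra.
From mathcomp Require Import all_classical all_reals all_analysis.

Set Implicit Arguments.
Unset Strict Implicit.
Unset Printing Implicit Defensive.

Import Order.TTheory GRing.Theory Num.Theory.
Import numFieldNormedType.Exports.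

Local Open Scope classical_set_scope.
Local Open Scope ring_scope.

(** * Positive semidefinite matrices and their entrywise powers *)

Section HadamardPowers.
Variables (C : numClosedFieldType) (n : nat).
Implicit Types (A : 'M[C]_n) (c : 'I_n -> C).

Definition qform A c : C := \sum_i \sum_j c i * (c j)^* * A i j.

(** Unitary diagonalization: each eigenvalue is the value of the form at a row of [P], hence
    nonnegative. *)
Lemma psd_sum_rank1 A :
    (forall i j, A j i = (A i j)^*) -> (forall c, 0 <= qform A c) ->
  exists d : 'I_n -> C, exists v : 'I_n -> 'I_n -> C,
    (forall k, 0 <= d k) /\
    (forall i j, A i j = \sum_k d k * (v k i * (v k j)^*)).
Proof.
move=> hermA psdA; set P := spectralmx A; set D := spectral_diag A.
have unitP : P \is unitarymx by exact: spectral_unitarymx.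
have eqA : A = (map_mx (@Num.conj C) P^T) *m diag_mx D *m P.
  rewrite -[map_mx _ _]invmx_unitary //; apply/orthomx_spectralP.
  apply: hermitian_normalmx; apply/is_hermitianmxP.
  by rewrite expr0 scale1r; apply/matrixP => i j; rewrite !mxE hermA.
exists (D 0), (fun k i => (P k i)^*); split => [k|i j].
  have -> : D 0 k = qform A (P k).
    have -> : D 0 k = (P *m A *m (map_mx (@Num.conj C) P^T)) k k.
      rewrite eqA !mulmxA (unitarymxP unitP) mul1mx -mulmxA.
      by rewrite (unitarymxP unitP) mulmx1 mxE eqxx mulr1n.
    rewrite mxE /qform exchange_big /=; apply: eq_bigr => j _.
    rewrite !mxE mulr_suml; apply: eq_bigr => i _.
    by rewrite mulrAC.
  exact: psdA.
rewrite [in LHS]eqA mxE; apply: eq_bigr => k _.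
by rewrite mul_mx_diag !mxE conjCK mulrA (mulrC (D 0 k)).
Qed.

(* One induction on m yields both the Schur product theorem for powers and the
   description of the isotropic vectors: a decomposition of A into rank one
   matrices expresses the form of power m.+1 through that of power m. *)
Lemma hadamard_power_psd A (m : nat) c :
    (forall i j, A j i = (A i j)^*) -> (forall c, 0 <= qform A c) ->
  let Q := \sum_i \sum_j c i * (c j)^* * A i j ^+ m in
  0 <= Q /\ (Q = 0 -> forall j, \sum_i c i * A i j ^+ m = 0).
Proof.
move=> hermA psdA; have [d [v [d_ge0 eqA]]] := psd_sum_rank1 hermA psdA.
elim: m c => [|m IHm] c /=.
  have -> : \sum_i \sum_j c i * (c j)^* * A i j ^+ 0 = `|\sum_i c i| ^+ 2.
    rewrite normCK rmorph_sum mulr_suml; apply: eq_bigr => i _ /=.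
    by rewrite mulr_sumr; apply: eq_bigr => j _; rewrite expr0 mulr1.
  split=> [|/eqP]; first exact: exprn_ge0.
  rewrite sqrf_eq0 normr_eq0 => /eqP c0 j; rewrite -[RHS]c0.
  by apply: eq_bigr => i _; rewrite expr0 mulr1.
pose cv k i := c i * v k i.
pose Q k := \sum_i \sum_j cv k i * (cv k j)^* * A i j ^+ m.
have -> : \sum_i \sum_j c i * (c j)^* * A i j ^+ m.+1 = \sum_k d k * Q k.
  rewrite /Q; under [RHS]eq_bigr do rewrite mulr_sumr.
  rewrite [RHS]exchange_big /=; apply: eq_bigr => i _.
  under [RHS]eq_bigr do rewrite mulr_sumr.
  rewrite [RHS]exchange_big /=; apply: eq_bigr => j _.
  rewrite exprS {1}eqA mulrCA mulr_suml; apply: eq_bigr => k _.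
  by rewrite /cv rmorphM /=; ring.
have dQ_ge0 k : true -> 0 <= d k * Q k.
  by move=> _; rewrite mulr_ge0 //; have [] := IHm (cv k).
split=> [|/eqP]; first by apply: sumr_ge0 => k _; apply: dQ_ge0.
rewrite psumr_eq0 // => /allP dQ0 j.
transitivity (\sum_k d k * ((v k j)^* * \sum_i cv k i * A i j ^+ m)).
  under [RHS]eq_bigr do rewrite mulr_sumr mulr_sumr.
  rewrite [RHS]exchange_big /=; apply: eq_bigr => i _.
  rewrite exprS {1}eqA mulrCA mulr_suml; apply: eq_bigr => k _.
  by rewrite /cv; ring.
(* For each [k], either [d k] vanishes or [cv k] is isotropic, hence null, for the power [m]. *)
apply: big1 => k _; have := dQ0 k (mem_index_enum k).
rewrite mulf_eq0 => /orP[/eqP-> | /eqP Qk0]; first by rewrite mul0r.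
by have [_ /(_ Qk0 j) ->] := IHm (cv k); rewrite !mulr0.
Qed.

Lemma moments_separate (R : realDomainType) A (N : 'I_n -> R) c :
    (forall i j, i != j -> N i <= N j -> A i j != A j j) ->
    (forall m j, \sum_i c i * A i j ^+ m = 0) ->
  forall i, c i = 0.
Proof.
move=> sepA mom0 i0; apply/eqP/negPn/negP => ci0.
case: (@arg_maxP _ _ _ i0 (fun i => c i != 0) N ci0) => j cj Nj.
(* On the support of [c], [p] kills every entry of column [j] but the diagonal one, where maximality
   of [N j] keeps it nonzero; only [c j * p.[A j j]] survives in the sum. *)
pose p := \prod_(i | (c i != 0) && (i != j)) ('X - (A i j)%:P).
have : \sum_i c i * p.[A i j] = 0.
  under eq_bigr do rewrite horner_coef mulr_sumr.
  rewrite exchange_big big1 //= => m _.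
  transitivity (p`_m * \sum_i c i * A i j ^+ m); last by rewrite mom0 mulr0.
  by rewrite mulr_sumr; apply: eq_bigr => i _; rewrite mulrCA.
rewrite (bigD1 j) //= big1 ?addr0 => [/eqP|i ij].
  rewrite mulf_eq0 (negPf cj) /= horner_prod => /prodf_eq0 [i /andP[ci ij]].
  by rewrite !hornerE subr_eq0 eq_sym (negPf (sepA _ _ ij (Nj i ci))).
have [->|ci] := eqVneq (c i) 0; first by rewrite mul0r.
by rewrite /p horner_prod (bigD1 i) ?ci //= hornerXsubC subrr mul0r mulr0.
Qed.

End HadamardPowers.

(** * Taylor estimates for functions with nonnegative derivatives at 0 *)

Section Taylor.
Variable R : realType.
Implicit Types (f : R -> R) (g : nat -> R -> R).

Lemma is_derive_ge0_le f f' (t : R) :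
    (forall s, is_derive s (1 : R) f (f' s)) ->
    (forall s, 0 <= s <= t -> 0 <= f' s) ->
  forall s, 0 <= s <= t -> f 0 <= f s.
Proof.
move=> df f'_ge0 s /andP[s0 st].
apply: (@ger0_derive1_ndecr _ f 0 t) => // [x xt|].
- rewrite derive1E derive_val; apply: f'_ge0.
  by move: xt; rewrite in_itv /= => /andP[/ltW-> /ltW->].
- apply: continuous_subspaceT => x.
  by apply: differentiable_continuous; apply/derivable1_diffP; case: (df x).
Qed.

Variables (g : nat -> R -> R) (t : R).
Hypothesis dg : forall k s, is_derive s (1 : R) (g k) (g k.+1 s).
Hypothesis g0_ge0 : forall k, 0 <= g k 0.

Lemma is_derive_exp_coeffM (a : R) m (s : R) :
  is_derive s (1 : R) (fun s => exp_coeff (a * s) m.+1) (a * exp_coeff (a * s) m).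
Proof.
have -> : (fun s => exp_coeff (a * s) m.+1) =
    (a ^+ m.+1 / m.+1`!%:R) *: (id : R -> R) ^+ m.+1.
  apply/funext => x; rewrite /exp_coeff /= exprMn mulrAC.
  by rewrite /GRing.scale /= exprfctE.
apply: is_derive_eq.
rewrite /exp_coeff /= /GRing.scale /= exprMn exprS factS natrM /=.
have : m`!%:R != 0 :> R by rewrite pnatr_eq0 -lt0n fact_gt0.
have : m.+1%:R != 0 :> R by rewrite pnatr_eq0.
move: m.+1%:R m`!%:R => p q p0 q0.
by field; rewrite q0 p0.
Qed.

(** Integrating the bound on [g k.+1] from 0, where [g k] is nonnegative, replaces the factor
    [(M s)^m / m!] by the next one. *)
Lemma taylor_lower_bound (A M : R) :
    (forall k s, 0 <= s <= t -> - (A * M ^+ k) <= g k s) ->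
  forall m k s, 0 <= s <= t -> - (A * M ^+ k * exp_coeff (M * s) m) <= g k s.
Proof.
move=> bound; elim=> [|m IHm] k s st.
  by rewrite /exp_coeff /= expr0 fact0 divr1 mulr1; apply: bound.
pose f s := g k s + A * M ^+ k * exp_coeff (M * s) m.+1.
pose f' s := g k.+1 s + A * M ^+ k * (M * exp_coeff (M * s) m).
have df x : is_derive x (1 : R) f (f' x).
  have dh := is_deriveZ (A * M ^+ k) (is_derive_exp_coeffM M m x).
  exact: is_deriveD (dg k x) dh.
have f'_ge0 x : 0 <= x <= t -> 0 <= f' x.
  by move=> /(IHm k.+1); rewrite /f' exprSr; lra.
have := is_derive_ge0_le df f'_ge0 st.
rewrite /f /exp_coeff /= mulr0 expr0n mul0r mulr0 addr0.
have := g0_ge0 k; lra.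
Qed.

(** The derivatives grow at most geometrically, so the error [(M s)^m / m!] tends to 0 as [m]
    grows. *)
Lemma taylor_ge0 (A M : R) :
    (forall k s, 0 <= s <= t -> - (A * M ^+ k) <= g k s) ->
  forall k s, 0 <= s <= t -> 0 <= g k s.
Proof.
move=> bound k s st; rewrite -oppr_le0.
have cvg0 : (fun m => A * M ^+ k * exp_coeff (M * s) m) @ \oo --> (0 : R).
  rewrite -[0 in X in _ --> X](mulr0 (A * M ^+ k)).
  by apply: cvgMr; apply: cvg_exp_coeff.
have /cvg_lim <- // := cvg0.
apply: limr_ge; first by apply/cvg_ex; exists 0.
by apply: nearW => m; have := taylor_lower_bound bound m k st; lra.
Qed.

Hypothesis g_ge0 : forall k s, 0 <= s <= t -> 0 <= g k s.

Lemma taylor_term_le k s : 0 <= s <= t -> g k 0 * exp_coeff s k <= g 0%N s.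
Proof.
(* The starting order [i] varies because the bound for [g i] comes from integrating the one for
   [g i.+1]. *)
have H m : forall i s, 0 <= s <= t -> g (i + m)%N 0 * exp_coeff s m <= g i s.
  elim: m => [|m IHm] i x xt.
    rewrite /exp_coeff /= expr0 fact0 divr1 mulr1 addn0.
    exact: (is_derive_ge0_le (dg i) (g_ge0 i.+1) xt).
  pose f s := g i s - g (i + m.+1)%N 0 * exp_coeff s m.+1.
  pose f' s := g i.+1 s - g (i + m.+1)%N 0 * exp_coeff s m.
  have df y : is_derive y (1 : R) f (f' y).
    have := is_derive_exp_coeffM 1 m y; rewrite !mul1r.
    under eq_fun do rewrite mul1r.
    move=> /(is_deriveZ (g (i + m.+1)%N 0)) dh.
    exact: is_deriveB (dg i y) dh.
  have f'_ge0 y : 0 <= y <= t -> 0 <= f' y.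
    by move=> /(IHm i.+1); rewrite /f' addnS addSn subr_ge0.
  have := is_derive_ge0_le df f'_ge0 xt.
  rewrite /f /exp_coeff /= expr0n mul0r mulr0 subr0.
  have := g0_ge0 i; lra.
by move=> st; apply: (H k 0%N).
Qed.

End Taylor.

(** * The complex exponential along real multiples of a fixed number *)

Section ComplexExponential.
Variable R : realType.
Implicit Types (w z : R[i]) (s : R).
Local Open Scope complex_scope.

Lemma cexp0 : cexp 0 = 1 :> R[i].
Proof. by rewrite /cexp /= expR0 cos0 sin0 mulr1 mulr0. Qed.

Lemma cexpD z w : cexp (z + w) = cexp z * cexp w.
Proof.
case: z w => [a b] [c d]; rewrite /cexp /= expRD cosD sinD; simpc.
by congr (_ +i* _); ring.
Qed.

Lemma real_complex_conj s : (s%:C)^*%R = s%:C.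
Proof. exact: conjc_real. Qed.

Lemma cexp_conj z : cexp z^*%R = (cexp z)^*%R.
Proof.
by case: z => [a b]; rewrite /cexp /Num.conj /= cosN sinN mulrN.
Qed.

Lemma normc_cexp z : Normc.normc (cexp z) = expR (complex.Re z).
Proof.
case: z => [a b]; rewrite /cexp /= !exprMn -mulrDr cos2Dsin2 mulr1.
by rewrite sqrtr_sqr ger0_norm // expR_ge0.
Qed.

Lemma is_derive_Re_cexp w z s :
  is_derive s (1 : R) (fun s => complex.Re (w * cexp (s%:C * z)))
    (complex.Re (w * z * cexp (s%:C * z))).
Proof.
case: w z => [p q] [a b].
have E : (fun s : R => complex.Re ((p +i* q) * cexp (s%:C * (a +i* b)))) =
   (fun s : R => p * (expR (s * a) * cos (s * b)) -
                 q * (expR (s * a) * sin (s * b))).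
  by apply/funext => x; rewrite /cexp /=; simpc.
rewrite E.
apply: is_derive_eq.
rewrite /cexp /=; simpc => /=.
by rewrite /GRing.scale /=; ring.
Qed.

Lemma Re_le_normc z : `|complex.Re z| <= Normc.normc z.
Proof.
by case: z => [a b] /=; rewrite -sqrtr_sqr ler_wsqrtr // lerDl sqr_ge0.
Qed.

End ComplexExponential.

(** * The entrywise exponential of a positive semidefinite matrix *)

Section ExponentialOfPsd.
Variables (R : realType).

Lemma Re_sum (I : finType) (F : I -> R[i]) :
  complex.Re (\sum_i F i) = \sum_i complex.Re (F i).
Proof. by apply: (big_morph (@complex.Re R)) => // -[a b] [c d]. Qed.

Lemma ge0_Re_real (z : R[i]) : z^* = z -> 0 <= complex.Re z -> 0 <= z.
Proof.
case: z => a b; rewrite lecE /= => -[bN] ->; rewrite andbT.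
by rewrite -eqNr bN.
Qed.

Variables (n : nat) (A : 'M[R[i]]_n) (c : 'I_n -> R[i]).
Hypothesis hermA : forall i j, A j i = (A i j)^*.
Hypothesis psdA : forall c, 0 <= qform A c.

(** The [k]-th derivative in [s] of the form of the entrywise exponential; taking real parts keeps
    the calculus over [R]. *)
Let g (k : nat) (s : R) : R :=
  \sum_i \sum_j
    complex.Re (c i * (c j)^* * A i j ^+ k * cexp ((s%:C)%C * A i j)).

Let is_derive_g k s : is_derive s (1 : R) (g k) (g k.+1 s).
Proof.
have -> : g k = \sum_i \sum_j (fun s : R =>
    complex.Re (c i * (c j)^* * A i j ^+ k * cexp ((s%:C)%C * A i j))).
  by apply/funext => x; rewrite fct_sumE; apply: eq_bigr => i _; rewrite fct_sumE.
apply: is_derive_sum => i; apply: is_derive_sum => j.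
by rewrite exprSr mulrA; apply: is_derive_Re_cexp.
Qed.

Let g_at0 k :
  g k 0 = complex.Re (\sum_i \sum_j c i * (c j)^* * A i j ^+ k).
Proof.
rewrite Re_sum; apply: eq_bigr => i _; rewrite Re_sum; apply: eq_bigr => j _.
by rewrite mul0r cexp0 mulr1.
Qed.

Let g_at0_ge0 k : 0 <= g k 0.
Proof.
have [+ _] := hadamard_power_psd k c hermA psdA.
by rewrite g_at0 lecE => /andP[].
Qed.

(** Each derivative brings down a factor [A i j], of modulus at most the sum [M] of all moduli; [B]
    absorbs the exponentials on [[0, t]]. *)
Let g_bounded (t : R) :
  exists B M : R, forall k s, 0 <= s <= t -> - (B * M ^+ k) <= g k s.
Proof.
pose M := \sum_i \sum_j Normc.normc (A i j).
pose B := \sum_i \sum_j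
  Normc.normc (c i * (c j)^*) * expR (t * `|complex.Re (A i j)|).
have nge0 (z : R[i]) : 0 <= Normc.normc z by case: z => a b; apply: sqrtr_ge0.
have normcX (z : R[i]) k : Normc.normc (z ^+ k) = Normc.normc z ^+ k.
  elim: k => [|k IHk]; first by rewrite Normc.normc1.
  by rewrite !exprS Normc.normcM IHk.
exists B, M => k s /andP[s0 st]; rewrite lerNl.
apply: le_trans (ler_norm _) _; rewrite normrN.
rewrite /g /B mulr_suml; apply: le_trans (ler_norm_sum _ _ _) _.
apply: ler_sum => i _; rewrite mulr_suml; apply: le_trans (ler_norm_sum _ _ _) _.
apply: ler_sum => j _; apply: le_trans (Re_le_normc _) _.
rewrite 2!Normc.normcM normc_cexp normcX mulrAC.
apply: ler_pM => //.
- by rewrite mulr_ge0 // expR_ge0.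
- exact: exprn_ge0.
- apply: ler_wpM2l => //; rewrite ler_expR.
  have -> : complex.Re ((s%:C)%C * A i j) = s * complex.Re (A i j).
    by case: (A i j) => a b /=; rewrite mul0r subr0.
  apply: le_trans (ler_norm _) _; rewrite normrM (ger0_norm s0).
  exact: ler_wpM2r.
- apply: lerXn2r; rewrite ?nnegrE //.
    by apply: sumr_ge0 => p _; apply: sumr_ge0.
  rewrite /M (bigD1 i) //= (bigD1 j) //= -addrA lerDl addr_ge0 //.
    exact: sumr_ge0.
  by apply: sumr_ge0 => p _; apply: sumr_ge0.
Qed.

Lemma cexp_psd (t : R) : 0 < t ->
  let Q := \sum_i \sum_j c i * (c j)^* * cexp ((t%:C)%C * A i j) in
  0 <= Q /\ (Q = 0 -> forall m j, \sum_i c i * A i j ^+ m = 0).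
Proof.
move=> t0 Q; have [B [M bound]] := g_bounded t.
have g_ge0 := taylor_ge0 is_derive_g g_at0_ge0 bound.
have tt : 0 <= t <= t by rewrite lexx ltW.
have ReQ : complex.Re Q = g 0%N t.
  rewrite Re_sum; apply: eq_bigr => i _; rewrite Re_sum; apply: eq_bigr => j _.
  by rewrite expr0 mulr1.
have conjE i j :
    (cexp ((t%:C)%C * A i j))^* = cexp ((t%:C)%C * A j i).
  by rewrite -cexp_conj rmorphM /= real_complex_conj -hermA.
split.
  (* Nonnegativity in [R[i]] includes being real: conjugating [Q] only swaps its two indices. *)
  apply: ge0_Re_real; last by rewrite ReQ; apply: g_ge0.
  rewrite rmorph_sum /Q exchange_big; apply: eq_bigr => i _ /=.
  rewrite rmorph_sum; apply: eq_bigr => j _ /=.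
  by rewrite !rmorphM /= conjCK conjE (mulrC (c j)).
move=> Q0 m; have [H0 H1] := hadamard_power_psd m c hermA psdA.
apply: H1; apply/eqP; rewrite eq_le H0 andbT lecE; move: H0.
rewrite lecE => /andP[/= /eqP -> _]; rewrite eqxx -g_at0 /=.
(* As [g 0 t] is 0 and [t^m / m!] is positive, the Taylor term of order [m] forces [g m 0 <= 0]. *)
have := taylor_term_le is_derive_g g_at0_ge0 g_ge0 m tt.
by rewrite -ReQ Q0 /= pmulr_lle0 // /exp_coeff /= divr_gt0 ?exprn_gt0 //.
Qed.

End ExponentialOfPsd.

(** * Strict positivity of exponential and rescaled kernels *)

Section KernelLemmas.
Variables (R : realType) (X : Type).

(** [G] will be the Gram kernel or its real part, and [N] the squared norm. *)
Lemma strictly_positive_cexp (G : X -> X -> R[i]) (N : X -> R) (t : R) :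
    (forall x y, G y x = (G x y)^*) ->
    (forall n (x : 'I_n -> X) (c : 'I_n -> R[i]),
      0 <= \sum_i \sum_j c i * (c j)^* * G (x i) (x j)) ->
    (forall x y, N x <= N y -> G x y = G y y -> x = y) ->
    0 < t ->
  strictly_positive_kernel (fun x y => cexp ((t%:C)%C * G x y)).
Proof.
move=> hermG psdG sepG t0.
have main n (x : 'I_n -> X) (c : 'rV[R[i]]_n) :
    let Q := \sum_(i < n) \sum_(j < n)
      c 0 i * (c 0 j)^* * cexp ((t%:C)%C * G (x i) (x j)) in
    0 <= Q /\ (injective x -> Q = 0 -> c = 0).
  pose A := \matrix_(i, j) G (x i) (x j).
  have hermA i j : A j i = (A i j)^* by rewrite !mxE hermG.
  have psdA d : 0 <= qform A d.
    have := psdG n x d; congr (0 <= _); apply: eq_bigr => i _.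
    by apply: eq_bigr => j _; rewrite mxE.
  move=> Q; have [] := cexp_psd (c 0) hermA psdA t0.
  have -> : \sum_i \sum_j c 0 i * (c 0 j)^* * cexp ((t%:C)%C * A i j) = Q.
    by apply: eq_bigr => i _; apply: eq_bigr => j _; rewrite mxE.
  move=> Q_ge0 mom; split=> // x_inj Q0; apply/rowP => i; rewrite mxE.
  apply: (moments_separate (N := N \o x) _ (mom Q0)) => p q pq Npq.
  apply: contra pq; rewrite !mxE => /eqP Gpq; apply/eqP/x_inj.
  exact: sepG Npq Gpq.
split; first split.
- by move=> x y; rewrite -cexp_conj rmorphM /= real_complex_conj hermG.
- by move=> n x c _; have [] := main n x c.
- move=> n x c _ x_inj c0; have [Q_ge0 Q0] := main n x c.
  by rewrite lt_neqAle Q_ge0 andbT eq_sym; apply: contra c0 => /eqP/(Q0 x_inj)->.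
Qed.

(** The factor [f] is absorbed into the coefficients, which stay not all zero since [f] never
    vanishes. *)
Lemma strictly_positive_scale (k : X -> X -> R[i]) (f : X -> R[i]) :
    (forall x, f x != 0) -> strictly_positive_kernel k ->
  strictly_positive_kernel (fun x y => f x * (f y)^* * k x y).
Proof.
move=> f0 [[hermk psdk] spk].
have E n (x : 'I_n -> X) (c : 'rV[R[i]]_n) :
    \sum_(i < n) \sum_(j < n)
      c 0 i * (c 0 j)^* * (f (x i) * (f (x j))^* * k (x i) (x j)) =
    let d := \row_i (c 0 i * f (x i)) in
    \sum_(i < n) \sum_(j < n) d 0 i * (d 0 j)^* * k (x i) (x j).
  apply: eq_bigr => i _; apply: eq_bigr => j _.
  by rewrite !mxE rmorphM /= mulrA mulrACA.
split; first split.
- by move=> x y; rewrite hermk !rmorphM /= conjCK (mulrC (f y)).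
- by move=> n x c n1; rewrite E; apply: psdk.
- move=> n x c n1 x_inj c0; rewrite E; apply: spk => //.
  apply: contra c0 => /eqP/rowP d0; apply/eqP/rowP => i.
  have := d0 i; rewrite !mxE => /eqP; rewrite mulf_eq0 (negPf (f0 _)) orbF.
  by move/eqP.
Qed.

End KernelLemmas.

(** * Gram kernels and their real parts *)

Section Gram.
Variables (R : realType) (H : lmodType R[i]) (ip : {dot H for @Num.conj R[i]}).

Lemma ip_conj u v : ip v u = (ip u v)^*.
Proof. by rewrite hermC expr0 mul1r. Qed.

Lemma gram_psd n (u : 'I_n -> H) (c : 'I_n -> R[i]) :
  0 <= \sum_i \sum_j c i * (c j)^* * ip (u j) (u i).
Proof.
(* The swapped arguments of [ip] call for conjugate coefficients in the vector whose squared norm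
   this is. *)
have -> : \sum_i \sum_j c i * (c j)^* * ip (u j) (u i) =
    ip (\sum_j (c j)^* *: u j) (\sum_i (c i)^* *: u i).
  rewrite linear_sumr; apply: eq_bigr => i _ /=.
  rewrite linear_sumlz; apply: eq_bigr => j _ /=.
  by rewrite [RHS]linearZl_LR [in RHS]linearZr_LR /= conjCK mulrA (mulrC (c i)).
exact: dnorm_ge0.
Qed.

(** Twice this form is the Gram form at [c] plus the one at its conjugate, which is the form of the
    conjugate Gram matrix at [c]. *)
Lemma Re_gram_psd n (u : 'I_n -> H) (c : 'I_n -> R[i]) :
  0 <= \sum_i \sum_j c i * (c j)^* * ((complex.Re (ip (u j) (u i)))%:C)%C.
Proof.
have H1 := gram_psd u c; have H2 := gram_psd u (fun i => (c i)^*).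
rewrite -(pmulr_rge0 _ (ltr0n _ 2)).
apply: le_trans (addr_ge0 H1 H2) _; rewrite le_eqVlt; apply/orP; left; apply/eqP.
rewrite [X in _ + X]exchange_big -big_split mulr_sumr /=; apply: eq_bigr => i _.
rewrite -big_split mulr_sumr /=; apply: eq_bigr => j _.
rewrite conjCK [(c j)^* * _]mulrC -mulrDr mulrCA -addcJ; congr (_ * (_ + _)).
by rewrite ip_conj.
Qed.

Lemma dnormB_Re u v :
  ip (u - v) (u - v) = ip u u + ip v v - 2 * ((complex.Re (ip v u))%:C)%C.
Proof.
by rewrite dnormB /= -addcJ (ip_conj v u) conjCK; congr (_ - _); rewrite addrC.
Qed.

(** Only the real part of [ip v u] enters the squared distance, so this serves both kernels. *)
Lemma gram_separates (u v : H) :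
    complex.Re (ip u u) <= complex.Re (ip v v) ->
    complex.Re (ip v u) = complex.Re (ip v v) -> u = v.
Proof.
move=> Nuv Rvu; apply/eqP.
rewrite -subr_eq0 -(dnorm_eq0 ip) eq_le dnorm_ge0 andbT.
have real w : ((complex.Re (ip w w))%:C)%C = ip w w.
  by rewrite RRe_real // ger0_real // dnorm_ge0.
have le_uv : ip u u <= ip v v by rewrite -real -(real v) lecR.
by rewrite dnormB_Re Rvu real mulr_natl mulr2n opprD addrACA subrr addr0 subr_le0.
Qed.

End Gram.

(* The Hilbert space is a complete normed space over R[i] whose norm, itself
   R[i]-valued, comes from the inner product ip; a {dot H for conj} is
   linear in its first variable and conjugate-linear in its second. *)
Theorem theorem3p5 (R : realType) (X : Type) (H : completeNormedModType R[i])
    (ip : {dot H for @Num.conj R[i]})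
    (ip_norm : forall u : H, `|u| ^+ 2 = ip u u)
    (Phi : X -> H) :
  injective Phi ->
  (forall t : R, 0 < t ->
    strictly_positive_kernel
      (fun x y : X => cexp ((t%:C)%C * ip (Phi y) (Phi x)))) /\
  (forall t : R, 0 < t ->
    strictly_positive_kernel
      (fun x y : X => cexp (- (t%:C)%C * `|Phi x - Phi y| ^+ 2))).
Proof.
move=> Phi_inj; pose N x : R := complex.Re (ip (Phi x) (Phi x)).
split=> t t0.
  apply: (strictly_positive_cexp (G := fun x y => ip (Phi y) (Phi x))
    (N := N)) => //.
  - by move=> x y; apply: ip_conj.
  - by move=> n x c; apply: gram_psd.
  - by move=> x y Nxy Gxy; apply/Phi_inj/(gram_separates Nxy); rewrite Gxy.
pose G x y : R[i] := ((complex.Re (ip (Phi y) (Phi x)))%:C)%C.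
pose f x : R[i] := cexp (- (t%:C)%C * ip (Phi x) (Phi x)).
have f_real x : (f x)^* = f x.
  by rewrite -cexp_conj rmorphM rmorphN /= real_complex_conj -ip_conj.
have f_neq0 x : f x != 0.
  apply/eqP => f0; have := normc_cexp (- (t%:C)%C * ip (Phi x) (Phi x)).
  by rewrite -/(f x) f0 Normc.normc0 => /eqP; rewrite lt_eqF ?expR_gt0.
(* Expanding the squared distance splits off the two squared norms, which give the factors [f x] and
   [f y], the latter real and so equal to its conjugate. *)
have -> : (fun x y => cexp (- (t%:C)%C * `|Phi x - Phi y| ^+ 2)) =
    (fun x y => f x * (f y)^* * cexp (((2 * t)%:C)%C * G x y)).
  apply/funext => x; apply/funext => y.
  rewrite ip_norm dnormB_Re f_real /f -!cexpD; congr cexp.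
  by rewrite rmorphM rmorph_nat /G; ring.
apply: strictly_positive_scale => //.
apply: (strictly_positive_cexp (N := N)); last exact: mulr_gt0.
- move=> x y; rewrite /G (ip_conj ip (Phi x) (Phi y)).
  by rewrite real_complex_conj; case: (ip _ _).
- by move=> n x c; apply: Re_gram_psd.
- by move=> x y Nxy [Gxy]; apply/Phi_inj/(gram_separates Nxy).
Qed.
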